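(* Let $X$ be a non-empty finite set and let $G$ be a self-similar, level-transitive subgroup of $\mathrm{Aut}(X^* )$ such that the normalizer of $G$ in $\mathrm{Aut}(X^* )$ contains a self-replicating, level-transitive subgroup. If $G$ satisfies an algebraic law, or $G$ has a nontrivial center, then the topological closure $\overline{G}$ of $G$ in $\mathrm{Aut}(X^* )$ is not Rabin-recognizable.
   Context: $X^*$ is the set of finite words over $X$ (empty word $\epsilon$), viewed as a rooted $|X|$-regular tree in which $w$ has children $wx$, $x\in X$; $X^n$ is the set of words of length $n$. $\mathrm{Aut}(X^* )$ is the group of automorphisms of this rooted tree. For $g\in\mathrm{Aut}(X^* )$ and $w\in X^*$, the section $g_w\in\mathrm{Aut}(X^* )$ is defined by $g(wu)=g(w)g_w(u)$ for all $u\in X^*$, and the label $g_{(w)}\in\mathrm{Sym}(X)$ is the permutation induced by $g_w$ on $X=X^1$. The map $g\mapsto (g_{(w)})_{w\in X^*}$ (the portrait of $g$) is a bijection $\mathrm{Aut}(X^* )\to \mathrm{Sym}(X)^{X^*}$; elements are identified with their portraits, and $\mathrm{Aut}(X^* )$ carries the corresponding product topology (with $\mathrm{Sym}(X)$ discrete). A subgroup $H$ is self-similar if $h_w\in H$ for all $h\in H$, $w\in X^*$; self-replicating if it is self-similar and for all $u\in X^*$ and $g\in H$ there is $h\in H$ with $h(u)=u$ and $h_u=g$; level-transitive if it acts transitively on $X^n$ for every $n$. A group satisfies an algebraic law if there is a nontrivial element of a free group (a nontrivial reduced group word) that evaluates to the identity under every substitution of its variables by elements of the group. Rabin-recognizability.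 Let $A=\mathrm{Sym}(X)$. A Rabin automaton is a tuple $\mathcal R=(S,X,A,\mathcal T,\mathcal I,\mathcal F)$ with $S$ a non-empty finite set of states, $\mathcal T\subseteq S\times A\times S^X$, $\mathcal I\subseteq S$ non-empty, and $\mathcal F$ a collection of subsets of $S$. A run of $\mathcal R$ on $f\in A^{X^*}$ is a map $r:X^*\to S$ such that $r(\epsilon)\in\mathcal I$ and $(r(w);f_{(w)};(r(wx))_{x\in X})\in\mathcal T$ for all $w\in X^*$. A ray is the vertex set of an infinite directed path starting at $\epsilon$. The run is successful if for every ray $\pi$ the set $\{s\in S : r^{-1}(s)\cap\pi \text{ is infinite}\}$ belongs to $\mathcal F$. A set $W\subseteq A^{X^*}$ is Rabin-recognizable if there is a Rabin automaton $\mathcal R$ such that $W$ is exactly the set of $f\in A^{X^*}$ on which $\mathcal R$ has a successful run.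
   Formalization: The set X is assumed to have at least two elements; for |X| = 1 the claim fails, since Aut(X^* ) is trivial, G = 1 satisfies every hypothesis, and its closure is the whole one-point space, which is Rabin-recognizable. *)

(* Defs.v *)
From HB Require Import structures.
From mathcomp Require Import all_boot all_fingroup.
From mathcomp Require Import all_classical topology.

Set Implicit Arguments.
Unset Strict Implicit.
Unset Printing Implicit Defensive.

Local Open Scope classical_set_scope.
Local Open Scope group_scope.

(* The vertices of the tree X^* are the words [w : seq X]; the children of [w]
   are the words [rcons w x].  A bijection that fixes the root and maps children
   to children preserves levels, so its inverse maps children to children too. *)
Record tree_aut (X : finType) := TreeAut {
  aut_fun :> seq X -> seq X;
  aut_bij : bijective aut_fun;
  aut_root : aut_fun [::] = [::];
  aut_child : forall w x, exists y, aut_fun (rcons w x) = rcons (aut_fun w) y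
}.

HB.instance Definition _ (X : finType) := gen_eqMixin (tree_aut X).
HB.instance Definition _ (X : finType) := gen_choiceMixin (tree_aut X).

Section TreeAutGroup.
Variable X : finType.
Implicit Types (g h : tree_aut X) (u v w : seq X).

Lemma tree_autP g h : g =1 h -> g = h.
Proof.
case: g h => [g gb g0 gc] [h hb h0 hc] /= /funext gh.
by case: h / gh in hb h0 hc *; congr TreeAut; exact: Prop_irrelevance.
Qed.

Lemma size_aut g w : size (g w) = size w.
Proof.
elim/last_ind: w => [|w x IHw]; first by rewrite aut_root.
by have [y ->] := aut_child g w x; rewrite !size_rcons IHw.
Qed.

Fact one_aut_child (w : seq X) x : exists y, id (rcons w x) = rcons (id w) y.
Proof. by exists x. Qed.

Definition aut_one := TreeAut (inv_bij (fun=> erefl)) (erefl _) one_aut_child.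

Fact mul_aut_bij g h : bijective (g \o h).
Proof. by apply: bij_comp; exact: aut_bij. Qed.

Fact mul_aut_root g h : (g \o h) [::] = [::].
Proof. by rewrite /= !aut_root. Qed.

Fact mul_aut_child g h w x :
  exists y, (g \o h) (rcons w x) = rcons ((g \o h) w) y.
Proof. by have [y /= ->] := aut_child h w x; exact: aut_child. Qed.

(* Automorphisms act on the left: (g * h)(w) = g(h(w)). *)
Definition aut_mul g h :=
  TreeAut (mul_aut_bij g h) (mul_aut_root g h) (@mul_aut_child g h).

Fact aut_inv_ex g : {f : seq X -> seq X | cancel g f /\ cancel f g}.
Proof. by apply: cid; have [f gK fK] := aut_bij g; exists f. Qed.

Definition aut_inv_fun g := sval (aut_inv_ex g).

Lemma aut_funK g : cancel g (aut_inv_fun g).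
Proof. by rewrite /aut_inv_fun; case: aut_inv_ex => f []. Qed.

Lemma aut_inv_funK g : cancel (aut_inv_fun g) g.
Proof. by rewrite /aut_inv_fun; case: aut_inv_ex => f []. Qed.

Fact inv_aut_bij g : bijective (aut_inv_fun g).
Proof. by exists g; [exact: aut_inv_funK | exact: aut_funK]. Qed.

Fact inv_aut_root g : aut_inv_fun g [::] = [::].
Proof. by rewrite -{1}(aut_root g) aut_funK. Qed.

Fact inv_aut_child g w x :
  exists y, aut_inv_fun g (rcons w x) = rcons (aut_inv_fun g w) y.
Proof.
case/lastP E: (aut_inv_fun g (rcons w x)) => [|v y].
  by have := congr1 g E; rewrite aut_inv_funK aut_root; case: (w).
have := congr1 g E; rewrite aut_inv_funK; have [z ->] := aut_child g v y.
by case/rcons_inj=> -> _; exists y; rewrite aut_funK.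
Qed.

Definition aut_inv g :=
  TreeAut (inv_aut_bij g) (inv_aut_root g) (@inv_aut_child g).

Fact aut_mulA : associative aut_mul.
Proof. by move=> f g h; exact: tree_autP. Qed.

Fact aut_mul1g : left_id aut_one aut_mul.
Proof. by move=> g; exact: tree_autP. Qed.

Fact aut_mulg1 : right_id aut_one aut_mul.
Proof. by move=> g; exact: tree_autP. Qed.

Fact aut_mulVg : left_inverse aut_one aut_inv aut_mul.
Proof. by move=> g; apply: tree_autP => w /=; exact: aut_funK. Qed.

Fact aut_mulgV : right_inverse aut_one aut_inv aut_mul.
Proof. by move=> g; apply: tree_autP => w /=; exact: aut_inv_funK. Qed.

HB.instance Definition _ :=
  isGroup.Build (tree_aut X) aut_mulA aut_mul1g aut_mulg1 aut_mulVg aut_mulgV.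

End TreeAutGroup.

Section Sections.
Variable X : finType.
Implicit Types (g : tree_aut X) (u v w : seq X).

Definition section_fun g w u := drop (size w) (g (w ++ u)).

Lemma section_funE g w u : g (w ++ u) = g w ++ section_fun g w u.
Proof.
elim/last_ind: u => [|u x IHu].
  by rewrite /section_fun cats0 drop_oversize ?cats0// size_aut.
rewrite /section_fun -rcons_cat; have [y ->] := aut_child g (w ++ u) x.
by rewrite IHu rcons_cat drop_size_cat ?size_aut.
Qed.

Fact section_bij g w : bijective (section_fun g w).
Proof.
exists (section_fun g^-1 (g w)) => u.
  rewrite {1}/section_fun -section_funE.
  by rewrite (_ : g^-1 _ = w ++ u) ?size_aut ?drop_size_cat//; exact: aut_funK.
have := section_funE g^-1 (g w) u; rewrite (_ : g^-1 (g w) = w); last first.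
  exact: aut_funK.
move=> E; rewrite {1}/section_fun -E.
by rewrite (_ : g _ = g w ++ u) ?drop_size_cat ?size_aut//; exact: aut_inv_funK.
Qed.

Fact section_root g w : section_fun g w [::] = [::].
Proof. by rewrite /section_fun cats0 drop_oversize// size_aut. Qed.

Fact section_child g w u x :
  exists y, section_fun g w (rcons u x) = rcons (section_fun g w u) y.
Proof.
rewrite /section_fun -rcons_cat; have [y ->] := aut_child g (w ++ u) x.
by exists y; rewrite drop_rcons// size_aut size_cat leq_addr.
Qed.

Definition section g w : tree_aut X :=
  TreeAut (section_bij g w) (section_root g w) (@section_child g w).

Lemma sectionE g w u : g (w ++ u) = g w ++ section g w u.
Proof. exact: section_funE. Qed.

(* [x] is a dummy default: the word [section g w [:: x]] has length 1. *)
Definition label_fun g w (x : X) : X := head x (section g w [:: x]).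

Lemma label_funE g w x : section g w [:: x] = [:: label_fun g w x].
Proof.
rewrite /label_fun; have := size_aut (section g w) [:: x].
by case: (section g w [:: x]) => [|y []].
Qed.

Fact label_inj g w : injective (label_fun g w).
Proof.
move=> x y xy; have := label_funE g w y.
by rewrite -xy -label_funE => /(bij_inj (aut_bij _)) [].
Qed.

Definition label g w : {perm X} := perm (@label_inj g w).

Lemma labelE g w x : section g w [:: x] = [:: label g w x].
Proof. by rewrite permE label_funE. Qed.

End Sections.

(* Sym(X)^(X^* ), with the product of the discrete topologies. *)
Definition portraits (X : finType) :=
  prod_topology (fun _ : seq X => discrete_topology {perm X}).

Definition portrait (X : finType) (g : tree_aut X) : portraits X := label g.

(* As [portrait] is a bijection, this is the topology of Sym(X)^(X^* ) carried
   over to Aut(X^* ). *)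
HB.instance Definition _ (X : finType) :=
  Topological.copy (tree_aut X) (initial_topology (@portrait X)).

Section Subgroups.
Variable gT : groupType.
Implicit Types H G : set gT.

Definition is_subgroup H := group_closed (mem H).

Definition normalizer G : set gT :=
  [set g | [set h ^ g | h in G] = G].

Definition center G : set gT :=
  [set z | G z /\ forall g, G g -> commute z g].

(* A group word in the variables x_0, x_1, ...: the letter (i, false) stands for
   x_i and (i, true) for its inverse. *)
Definition group_word := seq (nat * bool).

Definition reduced (w : group_word) :=
  sorted (fun a b => ~~ ((a.1 == b.1) && (a.2 != b.2))) w.

Definition eval_word (v : nat -> gT) (w : group_word) : gT :=
  \prod_(a <- w) (if a.2 then (v a.1)^-1 else v a.1).

Definition satisfies_law G :=
  exists w : group_word, [/\ w != [::], reduced w &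
    forall v : nat -> gT, (forall i, G (v i)) -> eval_word v w = 1].

End Subgroups.

Section SelfSimilar.
Variable X : finType.
Implicit Types H : set (tree_aut X).

Definition self_similar H := forall h w, H h -> H (section h w).

Definition self_replicating H :=
  self_similar H /\
  forall u g, H g -> exists h, [/\ H h, h u = u & section h u = g].

Definition level_transitive H :=
  forall n (u v : seq X), size u = n -> size v = n ->
    exists2 h, H h & h u = v.

End SelfSimilar.

Record rabin_automaton (X : finType) (A : Type) := RabinAutomaton {
  state : finType;
  state_nonempty : [set: state] !=set0;
  transitions : set (state * A * (X -> state));
  initial : set state;
  initial_nonempty : initial !=set0;
  acceptance : set (set state)
}.

Section Rabin.
Variables (X : finType) (A : Type).
Implicit Types (R : rabin_automaton X A) (f : seq X -> A).

Definition is_ray (pi : set (seq X)) :=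
  exists p : nat -> seq X, [/\ p 0 = [::],
    forall n, exists x, p n.+1 = rcons (p n) x & pi = range p].

Definition is_run R f (r : seq X -> state R) :=
  initial (r [::]) /\
  forall w, transitions (r w, f w, fun x => r (rcons w x)).

Definition successful R (r : seq X -> state R) :=
  forall pi, is_ray pi ->
    acceptance [set s | infinite_set (r @^-1` [set s] `&` pi)].

Definition rabin_recognizable (W : set (seq X -> A)) :=
  exists R : rabin_automaton X A,
    W = [set f | exists2 r, @is_run R f r & successful r].

End Rabin.

(* Main.v *)
Require Import Defs.
From mathcomp Require Import all_boot all_fingroup.
From mathcomp Require Import all_classical topology.

(** Write [H] for the closure of [G]. The idea is that a finite automaton cannot
    transport information across a vertex, so a level-transitive group with a
    Rabin-recognizable closure is weakly branch: for every vertex [w], [H]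
    contains a nontrivial element that moves only words below [w]
    ([rabin_rist], [all_rists_nontrivial]).

    Suppose that two successful runs, on portraits of [g] and [g'] in [H],
    assign the same state to [w]. Replacing in [g] the subtree at [w] by that of
    [g'] gives a portrait with a successful run ([rabin_graft]), as whether a ray
    is accepted depends only on the states far along the ray. If moreover
    [g w = g' w], the resulting automorphism [k] lies in [H], and [g^-1 * k]
    moves only words below [w]. If there were no nontrivial such elements for
    the vertices [w] of level [n], then an element of [H] would be determined by
    its action on level [n] and by the states at level [n] of one of its runs.
    These are finitely many data, whereas [H] is infinite, since it acts
    transitively on arbitrarily large levels.

    A weakly branch group has trivial centralizer ([centralizer_trivial]): if
    [z] moves [u], then [z] does not commute with an [s] that moves words below
    [u] only. It satisfies no law ([no_law]) by an argument of Abert: given a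
    reduced word, one builds, letter by letter, a substitution and a vertex
    whose successive images under the letters of the word are distinct
    ([uniq_trajectory]). When a new letter would bring the last point back to an
    earlier one, its variable is multiplied by an element that moves words below
    the last point only, which leaves the rest of the trajectory unchanged.
    Both properties contradict the hypothesis, because laws of [G] and
    commutation with [G] extend to [H]. *)

Set Implicit Arguments.
Unset Strict Implicit.
Unset Printing Implicit Defensive.

Local Open Scope classical_set_scope.
Local Open Scope group_scope.

Lemma uniq_map_inj (T U : eqType) (f : T -> U) (s : seq T) :
  uniq (map f s) -> {in s &, injective f}.
Proof.
elim: s => [//|z s IHs] /= /andP[fz /IHs fI] x y.
rewrite !inE => /predU1P[->|xs] /predU1P[->|ys]//; last exact: fI.
  by move=> fzy; rewrite fzy map_f in fz.
by move=> fxz; rewrite -fxz map_f in fz.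
Qed.

(** * Automorphisms of the tree *)

Section TreeAut.
Variable X : finType.
Implicit Types (g h s : tree_aut X) (u v w p : seq X) (G H : set (tree_aut X)).

Lemma aut_invK g u : g^-1 (g u) = u. Proof. exact: aut_funK. Qed.

Lemma aut_Kinv g u : g (g^-1 u) = u. Proof. exact: aut_inv_funK. Qed.

Lemma aut_inj g : injective g. Proof. exact: can_inj (aut_invK g). Qed.

Lemma aut_take g n u : take n (g u) = g (take n u).
Proof.
case: (leqP n (size u)) => [nu|/ltnW un].
  by rewrite -{1}(cat_take_drop n u) sectionE take_size_cat// size_aut size_takel.
by rewrite !take_oversize ?size_aut.
Qed.

Lemma aut_prefix g w u : prefix (g w) (g u) = prefix w u.
Proof. by rewrite !prefixE size_aut aut_take (inj_eq (@aut_inj g)). Qed.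

Lemma aut_rcons g w x : g (rcons w x) = rcons (g w) (label g w x).
Proof. by rewrite -cats1 sectionE labelE cats1. Qed.

Lemma portrait_inj : injective (@portrait X).
Proof.
move=> g h gh; apply: tree_autP; elim/last_ind => [|u x IHu].
  by rewrite !aut_root.
have lgh : label g u = label h u by have := congr1 (@^~ u) gh.
by rewrite !aut_rcons IHu lgh.
Qed.

Lemma prefix_rcons_new w u x :
  ~~ prefix w u -> prefix w (rcons u x) -> rcons u x = w.
Proof.
move=> wu /prefixP[v]; case/lastP: v => [|v y]; first by rewrite cats0.
by rewrite -rcons_cat => /rcons_inj[uv _]; rewrite uv prefix_prefix in wu.
Qed.

Lemma subgroup1 H : is_subgroup H -> H 1.
Proof. by case; rewrite inE. Qed.

Lemma subgroupV H g : is_subgroup H -> H g -> H g^-1.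
Proof. by move=> /group_closedV Hv Hg; have := Hv g; rewrite !inE; exact. Qed.

Lemma subgroupM H g h : is_subgroup H -> H g -> H h -> H (g * h).
Proof. by move=> /group_closedM HM Hg Hh; have := HM g h; rewrite !inE; exact. Qed.

(** * The closure of a group *)

(** The closure of [G], described level by level: any equation that involves
    finitely many words then passes from [G] to its closure. *)
Definition level_closure G : set (tree_aut X) :=
  [set g | forall n, exists2 h, G h & forall u, size u = n -> h u = g u].

Lemma sub_level_closure G : G `<=` level_closure G.
Proof. by move=> g Gg n; exists g. Qed.

Lemma nbhs_level g n :
  nbhs g [set h : tree_aut X | forall u, size u = n -> h u = g u].
Proof.
elim: n => [|n IHn].
  by apply: filterE => h u /size0nil->; rewrite !aut_root.
have nbhs_label (u : n.-tuple X) : nbhs g [set h : tree_aut X | label h u = label g u].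
  have pc : {for g, continuous (@portrait X)} by exact: initial_continuous.
  have lc : {for portrait g, continuous (fun f : portraits X => f (tval u))}.
    exact: (@proj_continuous _ (fun=> discrete_topology {perm X}) (tval u)).
  exact: (continuous_comp pc lc (discrete_set1 _)).
have nbhs_labels := filter_forall (nbhs_filter g) nbhs_label.
apply: filterS (filterI IHn nbhs_labels) => h /= [hg hgl].
case/lastP=> [//|u x]; rewrite size_rcons => -[un].
by rewrite !aut_rcons hg//; have /= -> := hgl (Tuple (introT eqP un)).
Qed.

Lemma closure_sub_level G : closure G `<=` level_closure G.
Proof. by move=> g /[swap] n /(_ _ (nbhs_level g n))[h [Gh hg]]; exists h. Qed.

Lemma inv_agree n g h : (forall u, size u = n -> h u = g u) ->
  forall u, size u = n -> h^-1 u = g^-1 u.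
Proof.
by move=> hg u un; apply: (@aut_inj h); rewrite aut_Kinv hg ?size_aut// aut_Kinv.
Qed.

Lemma level_closure_subgroup G : is_subgroup G -> is_subgroup (level_closure G).
Proof.
move=> Gg; split; first by rewrite inE; apply: sub_level_closure; exact: subgroup1.
move=> g h; rewrite !inE => Hg Hh n.
have [g' Gg' gg'] := Hg n; have [h' Gh' hh'] := Hh n.
exists (g' * h'^-1); first by apply: subgroupM => //; exact: subgroupV.
move=> u un; change (g' (h'^-1 u) = g (h^-1 u)).
by rewrite (inv_agree hh')// gg'// size_aut.
Qed.

(** * Evaluating group words on vertices *)

Definition letter (v : nat -> tree_aut X) (a : nat * bool) :=
  if a.2 then (v a.1)^-1 else v a.1.

Lemma eval_cons (v : nat -> tree_aut X) a (w : group_word) p :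
  eval_word v (a :: w) p = letter v a (eval_word v w p).
Proof. by rewrite /eval_word big_cons. Qed.

Lemma eval_nil (v : nat -> tree_aut X) p : eval_word v [::] p = p.
Proof. by rewrite /eval_word big_nil. Qed.

Lemma eval_agree n (v v' : nat -> tree_aut X) :
    (forall i u, size u = n -> v i u = v' i u) ->
  forall (w : group_word) u, size u = n -> eval_word v w u = eval_word v' w u.
Proof.
move=> vv' w u un; elim: w => [|a w IHw]; first by rewrite !eval_nil.
rewrite !eval_cons IHw /letter; case: a.2; last by rewrite vv'// size_aut.
by rewrite (inv_agree (vv' a.1))// size_aut.
Qed.

(** The action on a level of the value of a word depends only on the actions on
    that level of the substituted elements, which elements of [G] realize. *)
Lemma level_closure_law G : satisfies_law G -> satisfies_law (level_closure G).
Proof.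
move=> [w [w0 rw lw]]; exists w; split=> // v Hv; apply: tree_autP => u.
have /choice[v' Gv'] : forall i, exists h, G h /\
    forall u', size u' = size u -> h u' = v i u'.
  by move=> i; have [h] := Hv i (size u); exists h.
rewrite -(@eval_agree (size u) v')//; last by move=> i; case: (Gv' i).
by rewrite lw// => i; case: (Gv' i).
Qed.

Lemma level_closure_commute G z :
  (forall g, G g -> commute z g) -> forall g, level_closure G g -> commute z g.
Proof.
move=> zC g Hg; apply: tree_autP => u; have [h Gh hg] := Hg (size u).
change (z (g u) = g (z u)); rewrite -!hg ?size_aut//.
by have := congr1 (fun k : tree_aut X => k u) (zC h Gh).
Qed.

(** * Rigid stabilizers *)

(** The rigid stabilizer of [w] in the full automorphism group of the tree. *)
Definition rist w : set (tree_aut X) :=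
  [set s | s w = w /\ forall u, ~~ prefix w u -> s u = u].

Lemma rist_moves w s : rist w s -> s <> 1 -> exists u, s (w ++ u) != w ++ u.
Proof.
move=> [_ sw] s1; apply: contrapT => /forallNP ns; apply: s1.
apply: tree_autP => u; have [/prefixP[v ->]|/sw//] := boolP (prefix w u).
by apply/eqP; apply: contraT => /ns.
Qed.

Lemma rist_conj g w s : rist w s -> rist (g w) (g * s * g^-1).
Proof.
move=> [sw su]; split=> [|u gwu].
  by change (g (s (g^-1 (g w))) = g w); rewrite aut_invK sw.
change (g (s (g^-1 u)) = u); rewrite su ?aut_Kinv//.
by rewrite -(aut_prefix g) aut_Kinv.
Qed.

Lemma rist_inv w s : rist w s -> rist w s^-1.
Proof.
move=> [sw su]; split=> [|u /su {1}<-]; last exact: aut_invK.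
by rewrite -{1}sw aut_invK.
Qed.

Lemma rist_take w s p : rist w s -> take (size w) (s p) = take (size w) p.
Proof.
move=> [sw su]; have [wp|/su->//] := boolP (prefix w p).
by move: wp; rewrite aut_take prefixE => /eqP->.
Qed.

Definition rists_nontrivial H :=
  forall w, exists s, [/\ H s, rist w s & s <> 1].

(** Conjugation by [g] carries the rigid stabilizer of [w] to that of [g w]. *)
Lemma all_rists_nontrivial H : is_subgroup H -> level_transitive H ->
  (forall n, exists w s, [/\ size w = n, H s, rist w s & s <> 1]) ->
  rists_nontrivial H.
Proof.
move=> gH tH ristH w; have [w' [s [w'w Hs rs s1]]] := ristH (size w).
have [g Hg gw'] := tH _ w' w w'w erefl.
exists (g * s * g^-1); split; last 1 first.
- by move=> gs1; apply/s1/(mulgI g)/(mulIg g^-1); rewrite gs1 mulg1 mulgV.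
- by apply: subgroupM (subgroupV _ _) => //; exact: subgroupM.
- by rewrite -gw'; exact: rist_conj.
Qed.

(** If [z] moves [u] and [s] in the rigid stabilizer of [u] moves a word [p],
    then [s] fixes [z p], which is not below [u], whereas commutation would give
    [s (z p) = z (s p)], which differs from [z p]. *)
Lemma centralizer_trivial H z :
  rists_nontrivial H -> (forall g, H g -> commute z g) -> z = 1.
Proof.
move=> ristH zC; apply: tree_autP => u; apply/eqP; apply: contraT => /= zu.
have [s [Hs rs s1]] := ristH u; have [v suv] := rist_moves rs s1.
have szuv : s (z (u ++ v)) = z (u ++ v).
  case: rs => _; apply; apply: contra zu.
  by rewrite prefixE aut_take take_size_cat.
have : z (s (u ++ v)) = s (z (u ++ v)) := congr1 (fun g : tree_aut X => g _) (zC s Hs).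
by rewrite szuv => /aut_inj/eqP; rewrite (negPf suv).
Qed.

(** * Weakly branch groups satisfy no law *)

(** Since automorphisms act on the left, the letters are applied from the right
    end of the word, and the latest position of [p] comes first. *)
Fixpoint trajectory (v : nat -> tree_aut X) (w : group_word) p : seq (seq X) :=
  eval_word v w p :: if w is _ :: w' then trajectory v w' p else [::].

Lemma trajectoryE (v : nat -> tree_aut X) (w : group_word) p :
  trajectory v w p = eval_word v w p :: behead (trajectory v w p).
Proof. by case: w. Qed.

Lemma mem_trajectory_start (v : nat -> tree_aut X) (w : group_word) p :
  p \in trajectory v w p.
Proof.
elim: w => [|a w IHw] /=; first by rewrite eval_nil mem_head.
by rewrite inE IHw orbT.
Qed.

Lemma take_trajectory n (v : nat -> tree_aut X) (w : group_word) p :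
  map (take n) (trajectory v w p) = trajectory v w (take n p).
Proof. by elim: w => [|a w IHw] /=; rewrite aut_take ?IHw. Qed.

(** The change of the variable of the letter [a] that precomposes the value of
    [a] with [s], whatever the sign of [a]. *)
Definition perturb (v : nat -> tree_aut X) (a : nat * bool) s i :=
  if i == a.1 then if a.2 then s^-1 * v i else v i * s else v i.

Lemma letter_perturb (v : nat -> tree_aut X) a s :
  letter (perturb v a s) a = letter v a * s.
Proof. by rewrite /letter /perturb eqxx; case: a.2; rewrite // invgM invgK. Qed.

Lemma letter_perturb_inv (v : nat -> tree_aut X) a s :
  letter (perturb v a s) (a.1, ~~ a.2) = s^-1 * letter v (a.1, ~~ a.2).
Proof. by rewrite /letter /perturb eqxx; case: a.2; rewrite //= invgM. Qed.

Lemma letter_perturb_neq (v : nat -> tree_aut X) a c s :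
  c.1 != a.1 -> letter (perturb v a s) c = letter v c.
Proof. by rewrite /letter /perturb => /negPf->. Qed.

(** The perturbation acts only where [s] or [s^-1] meets a word below [y]. An
    occurrence of [a] applies [s] to its starting point, which is not the latest
    position of the trajectory; an occurrence of the inverse of [a] applies
    [s^-1] to its end point, which is the latest position only if this occurrence
    is the head of [w]; hence the last hypothesis, which holds vacuously when
    [a :: w] is reduced. *)
Lemma trajectory_perturb (v : nat -> tree_aut X) a s y (w : group_word) p :
    rist y s ->
    {in behead (trajectory v w p), forall q, ~~ prefix y q} ->
    (ohead w = Some (a.1, ~~ a.2) -> ~~ prefix y (eval_word v w p)) ->
  trajectory (perturb v a s) w p = trajectory v w p.
Proof.
move=> rs; elim: w => [|c w IHw] avoid head_avoid; first by rewrite /= !eval_nil.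
have avoid_q : ~~ prefix y (eval_word v w p).
  by apply: avoid; rewrite [behead _]trajectoryE mem_head.
have IH : trajectory (perturb v a s) w p = trajectory v w p.
  apply: IHw => // q qw; apply: avoid.
  by rewrite [behead _]trajectoryE inE qw orbT.
have := IH; rewrite trajectoryE [RHS]trajectoryE => -[eq_q _].
rewrite /= IH !eval_cons eq_q; congr (_ :: _).
have [c1a|/letter_perturb_neq->//] := eqVneq c.1 a.1.
have [c2a|c2a] := eqVneq c.2 a.2.
  have -> : c = a by rewrite [c]surjective_pairing c1a c2a; case: (a).
  rewrite letter_perturb.
  change (letter v a (s (eval_word v w p)) = letter v a (eval_word v w p)).
  by case: rs => _ ->.
have ca : c = (a.1, ~~ a.2).
  by rewrite [c]surjective_pairing c1a; congr (_, _); case: c.2 a.2 c2a => -[].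
rewrite ca letter_perturb_inv.
case: (rist_inv rs) => _; apply.
by rewrite -ca -eval_cons; apply: head_avoid; rewrite /= ca.
Qed.

Lemma reduced_cons a (w : group_word) :
  reduced (a :: w) -> ohead w <> Some (a.1, ~~ a.2).
Proof.
rewrite /reduced; case: w => //= c w /andP[ac _] [ca].
by move: ac; rewrite ca eqxx; case: a.2.
Qed.

(** Induction on the word. Before the letter [a] is added, the starting point is
    extended so that the last position [y] becomes a word [q] below [y] that is
    moved by some [s] in the rigid stabilizer of [y]. The positions remain
    distinct, as their prefixes at the former level are. Then [a q] or, after
    perturbing [a] by [s], [a (s q)] is a new position: these two differ but have
    the same prefix at the former level, which only one earlier position can
    share. *)
Lemma uniq_trajectory H (w : group_word) :
    is_subgroup H -> rists_nontrivial H -> reduced w ->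
  exists (v : nat -> tree_aut X) p, (forall i, H (v i)) /\ uniq (trajectory v w p).
Proof.
move=> gH ristH; elim: w => [|a w IHw] rw.
  by exists (fun=> 1), [::]; split=> // _; exact: subgroup1.
have [v [p [Hv up]]] := IHw (path_sorted rw).
set y := eval_word v w p; have [s [Hs rs s1]] := ristH y.
have [u suy] := rist_moves rs s1.
set q := y ++ u; set p' := (eval_word v w)^-1 q.
have eval_p' : eval_word v w p' = q by exact: aut_Kinv.
have take_p' : take (size y) p' = p.
  by rewrite aut_take take_size_cat// aut_invK.
have uniq_take : uniq (map (take (size y)) (trajectory v w p')).
  by rewrite take_trajectory take_p'.
have take_inj : {in trajectory v w p' &, injective (take (size y))}.
  exact: uniq_map_inj uniq_take.
have [new|old] := boolP (letter v a q \notin trajectory v w p').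
  exists v, p'; split=> //=.
  by rewrite eval_cons eval_p' new (map_uniq uniq_take).
have avoid : {in behead (trajectory v w p'), forall q', ~~ prefix y q'}.
  move=> q' q'T; apply/negP; rewrite prefixE => /eqP q'y.
  move: up; rewrite trajectoryE /= => /andP[/negP + _]; apply.
  by rewrite -/y -[X in X \in _]q'y -take_p' -take_trajectory behead_map map_f.
have same : trajectory (perturb v a s) w p' = trajectory v w p'.
  by apply: trajectory_perturb rs avoid _ => /(reduced_cons rw).
exists (perturb v a s), p'; split.
  move=> i; rewrite /perturb; case: eqP => // _.
  by case: a.2; apply: subgroupM => //; exact: subgroupV.
rewrite /= same (map_uniq uniq_take) andbT eval_cons.
have := same; rewrite trajectoryE [RHS]trajectoryE => -[-> _].
rewrite eval_p' letter_perturb; apply/negP => new.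
have /aut_inj sq : letter v a (s q) = letter v a q.
  by apply: take_inj; rewrite ?(negbNE old)// aut_take (rist_take _ rs) -aut_take.
by rewrite -[y ++ u]/q sq eqxx in suy.
Qed.

Lemma no_law H : is_subgroup H -> rists_nontrivial H -> ~ satisfies_law H.
Proof.
move=> gH ristH [[|a w] [// _ rw law]].
have [v [p [Hv]]] := uniq_trajectory gH ristH rw.
by rewrite /= law//= mem_trajectory_start.
Qed.

(** * Grafting subtrees *)

Definition graft A w (f f' : seq X -> A) : seq X -> A :=
  fun u => if prefix w u then f' u else f u.

Lemma graft_rcons A w (f f' : seq X -> A) u x : f w = f' w ->
  graft w f f' (rcons u x) = (if prefix w u then f' else f) (rcons u x).
Proof.
rewrite /graft => ff'; have [wu|wu] := boolP (prefix w u).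
  by rewrite -cats1 (prefix_trans wu (prefix_prefix _ _)).
by case: ifP => // /(prefix_rcons_new wu) ->.
Qed.

Lemma graft_aut w g g' : g w = g' w -> exists k : tree_aut X,
  k =1 graft w g g' /\ portrait k = graft w (portrait g) (portrait g').
Proof.
move=> gg'.
have bij_k : bijective (graft w g g').
  exists (graft (g w) (g^-1)%g (g'^-1)%g) => u; rewrite /graft.
    have [wu|/negPf wu] := boolP (prefix w u).
      by rewrite gg' aut_prefix wu aut_invK.
    by rewrite aut_prefix wu aut_invK.
  have gVwu h : prefix w (h^-1 u) = prefix (h w) u.
    by rewrite -(aut_prefix h) aut_Kinv.
  have [gwu|/negPf gwu] := boolP (prefix (g w) u).
    by rewrite gVwu -gg' gwu aut_Kinv.
  by rewrite gVwu gwu aut_Kinv.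
have root_k : graft w g g' [::] = [::] by rewrite /graft !aut_root if_same.
have child_k u x : exists y, graft w g g' (rcons u x) = rcons (graft w g g' u) y.
  by rewrite graft_rcons// /graft; case: ifP => _; exact: aut_child.
exists (TreeAut bij_k root_k child_k); split=> //.
apply/funext => u; apply/permP => x.
have := aut_rcons (TreeAut bij_k root_k child_k) u x.
rewrite /= graft_rcons// /graft /portrait.
by case: ifP => _; rewrite aut_rcons => /rcons_inj[].
Qed.

Lemma size_ray (p : nat -> seq X) : p 0 = [::] ->
  (forall n, exists x, p n.+1 = rcons (p n) x) -> forall n, size (p n) = n.
Proof.
move=> p0 pS; elim=> [|n IHn]; first by rewrite p0.
by have [x ->] := pS n; rewrite size_rcons IHn.
Qed.

Lemma prefix_ray (p : nat -> seq X) :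
    (forall n, exists x, p n.+1 = rcons (p n) x) ->
  forall m n, (m <= n)%N -> prefix (p m) (p n).
Proof.
move=> pS m; elim=> [|n IHn]; first by rewrite leqn0 => /eqP->; exact: prefix_refl.
rewrite leq_eqVlt => /predU1P[->|/IHn pmn]; first exact: prefix_refl.
by have [x ->] := pS n; rewrite -cats1 (prefix_trans pmn (prefix_prefix _ _)).
Qed.

(** The states seen infinitely often along a ray do not depend on a finite part of
    the ray. *)
Lemma limit_states_tail (S : Type) (p : nat -> seq X) (r r' : seq X -> S) m :
    (forall n, (m <= n)%N -> r (p n) = r' (p n)) ->
  [set s | infinite_set (r @^-1` [set s] `&` range p)] =
  [set s | infinite_set (r' @^-1` [set s] `&` range p)].
Proof.
have finite_tail (r1 r2 : seq X -> S) (s : S) :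
    (forall n, (m <= n)%N -> r1 (p n) = r2 (p n)) ->
    finite_set (r1 @^-1` [set s] `&` range p) ->
    finite_set (r2 @^-1` [set s] `&` range p).
  move=> r12 fin1; have fin : finite_set (r1 @^-1` [set s] `&` range p `|` p @` `I_m).
    by rewrite finite_setU; split=> //; exact/finite_image/finite_II.
  apply: sub_finite_set fin => _ [/[swap] -[n _ <-] /= r2s].
  have [mn|nm] := leqP m n; last by right; exists n.
  by left; split; [rewrite /= r12 | exists n].
move=> rr'; apply/seteqP; split=> s; apply: contra_not; apply: finite_tail => n mn.
  by rewrite rr'.
exact: rr'.
Qed.

(** A ray through [w] is eventually in the part taken from [r'], and any other ray
    stays in the part taken from [r]; the equality of states at [w] makes the
    transition into [w] legal. *)
Lemma rabin_graft (A : Type) (R : rabin_automaton X A) w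
    (f f' : seq X -> A) (r r' : seq X -> state R) :
    r w = r' w -> is_run f r -> successful r -> is_run f' r' -> successful r' ->
  is_run (graft w f f') (graft w r r') /\ successful (graft w r r').
Proof.
move=> rr' [ir tr] sr [ir' tr'] sr'; split.
  split; first by rewrite /graft; case: ifP.
  move=> u; have -> : (fun x => graft w r r' (rcons u x)) =
      (if prefix w u then fun x => r' (rcons u x) else fun x => r (rcons u x)).
    by apply/funext => x; rewrite graft_rcons//; case: ifP.
  by rewrite /graft; case: ifP.
move=> pi [p [p0 pS ->]].
have ray_p : is_ray (range p) by exists p.
have [wp|wp] := eqVneq (p (size w)) w.
  rewrite -(@limit_states_tail _ p r' _ (size w)); first exact: sr'.
  by move=> n wn; rewrite /graft -{1}wp prefix_ray.
rewrite -(@limit_states_tail _ p r _ 0); first exact: sr.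
move=> n _; rewrite /graft ifN//; apply: contraNN wp => wpn.
have wn : (size w <= n)%N by rewrite -[n](size_ray p0 pS) size_prefix.
have := prefix_ray pS wn; move: wpn.
by rewrite !prefixE (size_ray p0 pS) => /eqP-> /eqP<-.
Qed.

(** Otherwise an element of the closure is determined by its action on level [n]
    and the states at level [n] of a successful run, which makes the closure
    finite and contradicts the transitivity on deep levels. *)
Lemma rabin_rist G n : (1 < #|X|)%N -> is_subgroup G -> level_transitive G ->
    rabin_recognizable (@portrait X @` closure G) ->
  exists w s, [/\ size w = n, level_closure G s, rist w s & s <> 1].
Proof.
move=> X1 gG tG [R recG]; have gH := level_closure_subgroup gG.
apply: contrapT => no_rist.
have eq_below w g g' (r r' : seq X -> state R) : size w = n ->
    is_run (portrait g) r -> successful r ->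
    is_run (portrait g') r' -> successful r' ->
    level_closure G g -> g w = g' w -> r w = r' w ->
  forall u, g (w ++ u) = g' (w ++ u).
  move=> wn run_r suc_r run_r' suc_r' Hg gg' rr' u.
  have [k [kE kP]] := graft_aut gg'.
  have [run_k suc_k] := rabin_graft rr' run_r suc_r run_r' suc_r'.
  have Hk : level_closure G k.
    have : (@portrait X @` closure G) (portrait k).
      by rewrite recG kP; exists (graft w r r').
    by case=> h Gh /portrait_inj <-; exact: closure_sub_level.
  have k1 : g^-1 * k = 1.
    apply: contrapT => k1; apply: no_rist; exists w, (g^-1 * k); split=> //.
      exact: subgroupM gH (subgroupV gH Hg) Hk.
    split=> [|v wv].
      by change (g^-1 (k w) = w); rewrite kE /graft prefix_refl -gg' aut_invK.
    by change (g^-1 (k v) = v); rewrite kE /graft (negPf wv) aut_invK.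
  by rewrite -[g](mulg1) -k1 mulKVg kE /graft prefix_prefix.
have [x0 _] : exists x0 : X, x0 \in X by apply/card_gt0P; exact: leq_trans X1.
pose K := {ffun n.-tuple X -> n.-tuple X * state R}.
(* A level at least as deep as [n], with more than [#|K|] vertices. *)
pose N := (n + #|K|)%N.
pose u0 := nseq N x0.
have /choice[F FP] : forall v : N.-tuple X,
    exists gr : tree_aut X * (seq X -> state R), [/\ G gr.1,
      gr.1 u0 = v, is_run (portrait gr.1) gr.2 & successful gr.2].
  move=> v; have [g Gg gv] := tG N u0 v (size_nseq _ _) (size_tuple _).
  have : (@portrait X @` closure G) (portrait g).
    by exists g => //; exact: subset_closure.
  by rewrite recG => -[r run_r suc_r]; exists (g, r).
pose data (v : N.-tuple X) : K :=
  [ffun t : n.-tuple X => (insubd t ((F v).1 t), (F v).2 t)].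
have data_inj : injective data.
  move=> v v' /ffunP same; apply: val_inj => /=.
  have [[Gg <- run_r suc_r] [_ <- run_r' suc_r']] := (FP v, FP v').
  have nu0 : size (take n u0) == n by rewrite size_takel// size_nseq leq_addr.
  rewrite -(cat_take_drop n u0).
  have := same (Tuple nu0); rewrite !ffunE /= => -[/(congr1 val) + rr'].
  rewrite !val_insubd !size_aut nu0 => gg'.
  apply: eq_below run_r suc_r run_r' suc_r' _ gg' rr' _; first exact/eqP.
  exact: sub_level_closure.
have := leq_card data data_inj; rewrite card_tuple leqNgt => /negP; apply.
by apply: leq_trans (ltn_expl _ X1) _; rewrite leq_exp2l// leq_addl.
Qed.

End TreeAut.

Theorem theoremB (X : finType) (hX : (1 < #|X|)%N) (G : set (tree_aut X))
  (G_subgroup : is_subgroup G)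
  (G_self_similar : self_similar G)
  (G_level_transitive : level_transitive G)
  (G_normalizer : exists N : set (tree_aut X),
    [/\ is_subgroup N, N `<=` normalizer G,
        self_replicating N & level_transitive N])
  (G_law_or_center : satisfies_law G \/ exists2 z, center G z & z <> 1) :
  ~ rabin_recognizable (@portrait X @` closure G).
Proof.
move=> recG; have HG := level_closure_subgroup G_subgroup.
have HT : level_transitive (level_closure G).
  move=> n u v un vn; have [g Gg guv] := G_level_transitive n u v un vn.
  by exists g => //; exact: sub_level_closure.
have HR : rists_nontrivial (level_closure G).
  by apply: all_rists_nontrivial => // n; exact: rabin_rist recG.
case: G_law_or_center => [/level_closure_law|[z [_ zC]]]; first exact: no_law.
by apply; apply: centralizer_trivial HR _; exact: level_closure_commute.
Qed.
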